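(* Let $Y$ be a finite-dimensional subspace of the real Banach space $\ell_1$. Then $Y$ has property-$(HB)$ in $\ell_1$ if and only if $Y$ has property-$(U)$ in $\ell_1$ and there exists a bi-contractive projection $P:\ell_1\to Y$ onto $Y$ such that $Y$ and $(I-P)(\ell_1)$ are isometrically isomorphic to $\ell_1(\dim(Y))$ and $\ell_1$, respectively.
   Context: $\ell_1(n)$ is $\mathbb{R}^n$ with the $\ell_1$-norm. For a closed subspace $Y$ of a Banach space $X$, $Y^\perp=\{x^*\in X^*: x^*(y)=0\ \forall y\in Y\}$. $Y$ has property-$(U)$ in $X$ if every bounded linear functional on $Y$ has a unique norm-preserving extension to $X$. $Y$ has property-$(HB)$ in $X$ if there is a closed subspace $G$ of $X^*$ with $X^*=G\oplus Y^\perp$ such that for each $x^*\in X^*$, $\|x^*\|>\|y^\#\|$ and $\|x^*\|\ge\|y^\perp\|$ whenever $x^*=y^\#+y^\perp$ with $y^\#\in G$ and $0\ne y^\perp\in Y^\perp$. A linear projection $P$ is bi-contractive if $\|P\|\le1$ and $\|I-P\|\le 1$. *)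

(* Defs.v *)
From HB Require Import structures.
From mathcomp Require Import all_boot all_order all_algebra.
From mathcomp Require Import all_classical all_reals all_analysis.
Set Implicit Arguments.
Unset Strict Implicit.
Unset Printing Implicit Defensive.
Import Order.TTheory GRing.Theory Num.Theory.
Import numFieldNormedType.Exports.
Local Open Scope classical_set_scope.
Local Open Scope ring_scope.

Section Ell1.
Variable R : realType.

Definition abs_summable : {pred nat -> R^o} :=
  [pred x : nat -> R^o | `[< cvgn (series (fun k => `|x k| : R)) >]].

Lemma abs_summableP (x : nat -> R^o) :
  reflect (cvgn (series (fun k => `|x k| : R))) (x \in abs_summable).
Proof. exact: asboolP. Qed.

Lemma abs_summable_submod_closed : submod_closed abs_summable.
Proof.
split.
  apply/abs_summableP; rewrite [X in cvgn X](_ : _ = fun=> 0 : R).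
    exact: is_cvg_cst.
  by apply/funext => n /=; rewrite /series/= big1// => k _; rewrite normr0.
move=> a x y /abs_summableP cx /abs_summableP cy; apply/abs_summableP.
apply: (@series_le_cvg _ _ (fun n => `|a| * `|x n| + `|y n|)).
- by move=> n; exact: normr_ge0.
- by move=> n; rewrite addr_ge0// mulr_ge0.
- by move=> n /=; rewrite (le_trans (ler_normD _ _))// normrM.
- exact: (is_cvg_seriesD (is_cvg_seriesZ (k := `|a|) cx) cy).
Qed.

HB.instance Definition _ := GRing.isSubmodClosed.Build R (nat -> R^o)
  abs_summable abs_summable_submod_closed.

Record ell1 := Ell1 { ell1_val :> nat -> R^o; _ : ell1_val \in abs_summable }.
HB.instance Definition _ := [isSub for ell1_val].
HB.instance Definition _ := [Choice of ell1 by <:].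
HB.instance Definition _ := [SubChoice_isSubLmodule of ell1 by <:].

Definition ell1_norm (x : ell1) : R := limn (series (fun k => `|x k| : R)).

Lemma ell1_cvg (x : ell1) : cvgn (series (fun k => `|x k| : R)).
Proof. by case: x => x /= /abs_summableP. Qed.

Lemma ler_ell1_normD x y : ell1_norm (x + y) <= ell1_norm x + ell1_norm y.
Proof.
rewrite -lim_seriesD; [|exact: ell1_cvg..].
apply: lim_series_le; first exact: ell1_cvg.
  by apply: is_cvg_seriesD; exact: ell1_cvg.
by move=> n /=; exact: ler_normD.
Qed.

Lemma ell1_normZ (a : R) x : ell1_norm (a *: x) = `|a| * ell1_norm x.
Proof.
rewrite -[RHS]lim_seriesZ; last exact: ell1_cvg.
rewrite /ell1_norm; congr (limn (series _)).
by apply/funext => n; exact: normrM.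
Qed.

Lemma ell1_coord_le (x : ell1) k : `|x k| <= ell1_norm x.
Proof.
apply: (@le_trans _ _ (series (fun k => `|x k| : R) k.+1)).
  by rewrite /series/= big_nat_recr//= lerDr sumr_ge0.
apply: (nondecreasing_cvgn_le _ (@ell1_cvg x)).
by apply: nondecreasing_series => i _ _; exact: normr_ge0.
Qed.

Lemma ell1_norm0_eq0 x : ell1_norm x = 0 -> x = 0.
Proof.
move=> x0; apply/val_inj/funext => k /=.
by apply/eqP; rewrite -normr_le0 -x0 ell1_coord_le.
Qed.

HB.instance Definition _ := Lmodule_isNormed.Build R ell1
  ler_ell1_normD ell1_normZ ell1_norm0_eq0.

Lemma ell1_complete (F : set_system (ell1)) :
  ProperFilter F -> cauchy F -> cvg F.
Proof.
move=> FF Fc.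
have cF e : 0 < e -> exists x0 : ell1, \forall x \near F, `|x0 - x| < e.
  by move=> e0; have [x0] := (proj1 (cauchyP _) Fc) e e0; rewrite -ball_normE; exists x0.
have cvgk k : cvg ((fun x : ell1 => x k : R) @ F).
  apply: R_complete; apply/cauchyP => e /cF[x0 Fx0].
  exists (x0 k); rewrite -ball_normE; apply: filterS Fx0 => x; apply: le_lt_trans.
  exact: (ell1_coord_le (x0 - x)).
pose y : nat -> R^o := fun k => lim ((fun x : ell1 => x k : R) @ F).
have sumle (x0 : ell1) e n : (\forall x \near F, `|x0 - x| < e) ->
    series (fun k => `|x0 k - y k| : R) n <= e.
  move=> Fx0; rewrite /series/=.
  have cvs : (fun x : ell1 => \sum_(0 <= k < n) `|x0 k - x k| : R) @ F -->
      (\sum_(0 <= k < n) `|x0 k - y k| : R).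
    apply: cvg_big => [|k _]; first exact: add_continuous.
    apply: cvg_norm; apply: cvgB; first exact: cvg_cst.
    exact: cvgk.
  apply: (closed_cvg (fun z : R => z <= e) _ _ _ cvs); first exact: closed_le.
  apply: filterS Fx0 => x /ltW; apply: le_trans.
  apply: (nondecreasing_cvgn_le _ (@ell1_cvg (x0 - x))).
  by apply: nondecreasing_series => i _ _; exact: normr_ge0.
have sumd (x0 : ell1) e : (\forall x \near F, `|x0 - x| < e) ->
    cvgn (series (fun k => `|x0 k - y k| : R)).
  move=> Fx0; apply: nondecreasing_is_cvgn; first exact: nondecreasing_series.
  by exists e => _ [n _ <-]; exact: sumle.
have yP : y \in abs_summable.
  have [x0 Fx0] := cF 1 ltr01.
  have d : (x0 : nat -> R^o) - y \in abs_summable.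
    by apply/abs_summableP; exact: sumd Fx0.
  have -> : y = (x0 : nat -> R^o) - ((x0 : nat -> R^o) - y).
    by rewrite opprB addrC subrK.
  by rewrite rpredB//; exact: (valP x0).
apply/cvg_ex; exists (Ell1 yP); apply/cvgrPdist_le => /= e e0.
have e20 : 0 < e / 2 by rewrite divr_gt0.
have [x0 Fx0] := cF _ e20.
apply: filterS (Fx0) => x x0x.
rewrite (splitr e) -(subrKA x0) (le_trans (ler_normD _ _))// lerD ?(ltW x0x)//.
rewrite distrC; apply: limr_le; first exact: sumd Fx0.
by apply: nearW => n; exact: sumle.
Qed.
HB.instance Definition _ := Uniform_isComplete.Build ell1 ell1_complete.

End Ell1.

Section FinEll1.
Variables (R : realType) (n : nat).

(* A type of finite functions carries no norm of its own, whereas ['rV[R]_n]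
   is already equipped with the sup norm. *)
Definition fin_ell1 := {ffun 'I_n -> R^o}.
HB.instance Definition _ := GRing.Lmodule.on fin_ell1.

Definition fin_ell1_norm (x : fin_ell1) : R := \sum_(i < n) `|x i|.

Lemma ler_fin_ell1_normD x y :
  fin_ell1_norm (x + y) <= fin_ell1_norm x + fin_ell1_norm y.
Proof. by rewrite -big_split; apply: ler_sum => i _; rewrite ffunE ler_normD. Qed.

Lemma fin_ell1_normZ (a : R) x : fin_ell1_norm (a *: x) = `|a| * fin_ell1_norm x.
Proof. by rewrite mulr_sumr; apply: eq_bigr => i _; rewrite ffunE normrM. Qed.

Lemma fin_ell1_norm0_eq0 x : fin_ell1_norm x = 0 -> x = 0.
Proof.
move=> /eqP; rewrite psumr_eq0// => /allP x0; apply/ffunP => i.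
by apply/eqP; rewrite ffunE -normr_eq0; exact: x0.
Qed.

HB.instance Definition _ := Lmodule_isNormed.Build R fin_ell1
  ler_fin_ell1_normD fin_ell1_normZ fin_ell1_norm0_eq0.

End FinEll1.

Section Functionals.
Variables (R : realType) (X : normedModType R).
Implicit Types (Y : set X) (g : X -> R^o).

(* A bounded linear functional on a subspace [Y] is represented by a total
   function on [X], of which only the values on [Y] matter. *)
Definition bounded_functional_on Y g :=
  (forall (a : R) x y, Y x -> Y y -> g (a *: x + y) = a * g x + g y) /\
  exists M : R, forall y, Y y -> `|g y| <= M * `|y|.

(* The set is nonempty as soon as [Y] contains [0], and bounded above when
   [bounded_functional_on Y g] holds, so the supremum is a genuine one. *)
Definition functional_norm_on Y g : R :=
  sup [set `|g y| | y in Y `&` [set y | `|y| <= 1]].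

Definition dual_pred : {pred X -> R^o} :=
  [pred g : X -> R^o | `[< bounded_functional_on setT g >]].

Lemma dual_predP g : reflect (bounded_functional_on setT g) (g \in dual_pred).
Proof. exact: asboolP. Qed.

Lemma dual_submod_closed : submod_closed dual_pred.
Proof.
split.
  apply/dual_predP; split=> [a x y _ _|] /=; first by rewrite mulr0 addr0.
  by exists 0 => y _; rewrite normr0 mul0r.
move=> a f g /dual_predP[lf [M fM]] /dual_predP[lg [N gN]].
apply/dual_predP; split=> [b x y _ _|].
  rewrite /= !fctE lf// lg// !scalerDr /GRing.scale/= !mulrDr !addrA.
  by rewrite mulrCA; congr (_ + _); rewrite addrAC.
exists (`|a| * M + N) => y _; rewrite (le_trans (ler_normD _ _))//.
rewrite mulrDl lerD ?gN//.
by rewrite /GRing.scale/= normrM -mulrA ler_wpM2l// fM.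
Qed.

HB.instance Definition _ := GRing.isSubmodClosed.Build R (X -> R^o)
  dual_pred dual_submod_closed.

Record dual := Dual { dual_val :> X -> R^o; _ : dual_val \in dual_pred }.
HB.instance Definition _ := [isSub for dual_val].
HB.instance Definition _ := [Choice of dual by <:].
HB.instance Definition _ := [SubChoice_isSubLmodule of dual by <:].

Definition dual_norm (f : dual) : R := functional_norm_on setT f.

Lemma dual_bounded (f : dual) : bounded_functional_on setT f.
Proof. by case: f => f /= /dual_predP. Qed.

Lemma functional_norm_ub Y g : bounded_functional_on Y g ->
  has_ubound [set `|g y| | y in Y `&` [set y | `|y| <= 1]].
Proof.
move=> [_ [M gM]]; exists `|M| => _ [y [Yy y1] <-].
rewrite (le_trans (gM _ Yy))// (le_trans (ler_norm _))// normrM normr_id.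
by rewrite ler_piMr.
Qed.

Lemma dual_scale (f : dual) (a : R) x : f (a *: x) = a * f x.
Proof.
have [lf _] := dual_bounded f.
have f0 : f 0 = 0 :> R.
  have := lf 1 0 0 I I; rewrite scaler0 addr0 mul1r => /eqP.
  by rewrite -subr_eq subrr => /eqP.
by have := lf a x 0 I I; rewrite !addr0 f0 addr0.
Qed.

Lemma dual_norm_ub (f : dual) x : `|x| <= 1 -> `|f x| <= dual_norm f.
Proof.
move=> x1; apply: ub_le_sup; first exact: functional_norm_ub (dual_bounded f).
by exists x.
Qed.

Lemma dual_norm_le (f : dual) (M : R) :
  (forall x, `|x| <= 1 -> `|f x| <= M) -> dual_norm f <= M.
Proof.
move=> fM; apply: ge_sup; last by move=> _ [x [_ x1] <-]; exact: fM.
by exists `|f 0|, 0 => //; split=> //=; rewrite normr0.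
Qed.

Lemma dual_norm_ge0 (f : dual) : 0 <= dual_norm f.
Proof. by rewrite (le_trans (normr_ge0 (f 0)))// dual_norm_ub// normr0. Qed.

Lemma ler_dual_normD (f g : dual) : dual_norm (f + g) <= dual_norm f + dual_norm g.
Proof.
apply: dual_norm_le => x x1.
by rewrite (le_trans (ler_normD _ _))// lerD// dual_norm_ub.
Qed.

Lemma dual_normZ_le (a : R) (f : dual) : dual_norm (a *: f) <= `|a| * dual_norm f.
Proof.
apply: dual_norm_le => x x1.
by rewrite [leLHS]normrM ler_wpM2l// dual_norm_ub.
Qed.

Lemma dual_normZ (a : R) (f : dual) : dual_norm (a *: f) = `|a| * dual_norm f.
Proof.
apply/eqP; rewrite eq_le dual_normZ_le/=.
have [->|a0] := eqVneq a 0; first by rewrite normr0 mul0r dual_norm_ge0.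
rewrite mulrC -ler_pdivlMr ?normr_gt0//.
by rewrite -[in leLHS](scalerK a0 f) mulrC -normfV dual_normZ_le.
Qed.

Lemma dual_norm0_eq0 (f : dual) : dual_norm f = 0 -> f = 0.
Proof.
move=> f0; apply/val_inj/funext => x /=; apply/eqP; rewrite -normr_le0.
have [->|x0] := eqVneq x 0.
  by rewrite -(scale0r (0 : X)) dual_scale mul0r normr0.
have : `|f (`|x|^-1 *: x)| <= 0.
  by rewrite -f0 dual_norm_ub// normrZ normfV normr_id mulVf ?normr_eq0.
by rewrite dual_scale normrM pmulr_rle0// normfV normr_id invr_gt0 normr_gt0.
Qed.

HB.instance Definition _ := Lmodule_isNormed.Build R dual
  ler_dual_normD dual_normZ dual_norm0_eq0.

End Functionals.

Section Properties.
Variables (R : realType) (X : normedModType R).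
Implicit Type Y : set X.

Definition annihilator Y : set (dual X) :=
  [set f : dual X | forall y, Y y -> f y = 0].

Definition property_U Y := forall g : X -> R^o, bounded_functional_on Y g ->
  exists! f : dual X, (forall y, Y y -> f y = g y) /\ `|f| = functional_norm_on Y g.

Definition property_HB Y := exists G : set (dual X),
  [/\ closed G, submod_closed [in G],
      forall f : dual X, exists g h, [/\ G g, annihilator Y h & f = g + h],
      G `&` annihilator Y `<=` [set 0] &
      forall f g h : dual X, f = g + h -> G g -> annihilator Y h -> h != 0 ->
        `|g| < `|f| /\ `|h| <= `|f|].

Definition has_dim Y (n : nat) := exists b : 'I_n -> X,
  (forall c : 'I_n -> R, \sum_(i < n) c i *: b i = 0 -> forall i, c i = 0) /\
  Y = [set \sum_(i < n) c i *: b i | c in [set: 'I_n -> R]].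

Definition projection_onto (P : {linear X -> X}) Y :=
  (forall x, P (P x) = P x) /\ range P = Y.

Definition bi_contractive (P : {linear X -> X}) :=
  (forall x, `|P x| <= `|x|) /\ (forall x, `|x - P x| <= `|x|).

Definition isometrically_isomorphic (Z : normedModType R) Y :=
  exists T : {linear Z -> X}, (forall z, `|T z| = `|z|) /\ range T = Y.

End Properties.

(* Main.v *)
Require Import Defs.
From HB Require Import structures.
From mathcomp Require Import all_boot all_order all_algebra.
From mathcomp Require Import all_classical all_reals all_analysis.
From mathcomp Require Import lra.
Import numFieldNormedType.Exports.
Import Order.TTheory GRing.Theory Num.Theory.
Local Open Scope classical_set_scope.
Local Open Scope ring_scope.

(** Sufficiency holds in every normed space (property_HB_of_U). If [P] is a
    bi-contractive projection onto [Y], the complement of the annihilator of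
    [Y] is [G], the functionals [f] with [f \o P = f]; the decomposition of [f]
    is [f \o P + (f - f \o P)], and both parts have norm at most that of [f].
    If [f \o P] had the norm of [f], then [f] and [f \o P] would be two
    norm-preserving extensions of the restriction of [f] to [Y], so property
    (U) would give [f = f \o P]; this is the strict inequality.

    Necessity rests on the fact that a finite-dimensional subspace of [ell1]
    with property (HB) is zero (property_HB_dim0). For [Y = 0] the projection
    [0] does everything. So let [Y] be nonzero.

    Since [Y] is finite-dimensional, the projection of the dual onto [G] along
    the annihilator of [Y] is the adjoint of a projection [P] onto [Y], and [P]
    is bi-contractive because its adjoint is. Let [p_jk] be the matrix of [P],
    with columns [P e_k]. Bi-contractivity of the column [k] says that its
    off-diagonal part has norm at most [min(p_kk, 1 - p_kk)]; in particular
    off-diagonal entries are at most 1/2. Comparing diagonal entries in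
    [P P = P] gives [p_kk (1 - p_kk) = \sum_(j != k) p_kj p_jk], where the right
    side is at most half of the norm of the off-diagonal part of the column
    [k]. Two consequences follow.
    - If [p_kk < 1/2], then the column [k] is zero (small_diag_zero_col).
    - If the column [k] is zero, then the term [p_jk p_kj] disappears from the
      identity for [p_jj]. As [min(p, 1 - p) <= 2 p (1 - p)] on [0, 1], the
      identity leaves no room for the entry [p_kj], which must be zero: the row
      [k] is zero as well (zero_col_zero_row).

    Finite rank forces [p_kk] to tend to 0, so some row [k] is zero, that is,
    all elements of [Y] vanish at [k]. This contradicts the strictness of (HB):
    changing the [k]-th coordinate of a nonzero [g] in [G] adds an element of
    the annihilator to it, and this can be done without changing the norm
    (property_HB_not_vanishing). *)

(** * Functionals on a normed space *)

Section DualPairing.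
Context {R : realType} {X : normedModType R}.
Implicit Types (f g : dual X) (x y : X).

Lemma dual_evalD f g x : (f + g) x = f x + g x.
Proof. by []. Qed.

Lemma dual_evalZ (a : R) f x : (a *: f) x = a * f x.
Proof. by []. Qed.

Lemma dual_evalB f g x : (f - g) x = f x - g x.
Proof. by []. Qed.

Lemma dual_eval_sum (I : Type) (s : seq I) (F : I -> dual X) x :
  (\sum_(i <- s) F i) x = \sum_(i <- s) F i x.
Proof. exact: (big_morph (fun f : dual X => f x)). Qed.

Lemma dualD f x y : f (x + y) = f x + f y.
Proof. by have [/(_ 1 x y I I)] := dual_bounded f; rewrite scale1r mul1r. Qed.

Lemma dual0 f : f 0 = 0.
Proof. by rewrite -(scale0r (0 : X)) dual_scale mul0r. Qed.

Lemma dualB f x y : f (x - y) = f x - f y.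
Proof. by rewrite dualD -scaleN1r dual_scale mulN1r. Qed.

Lemma dual_sum (I : Type) (s : seq I) f (F : I -> X) :
  f (\sum_(i <- s) F i) = \sum_(i <- s) f (F i).
Proof. exact: (big_morph f (dualD f) (dual0 f)). Qed.

Lemma dual_eval_le f x : `|f x| <= `|f| * `|x|.
Proof.
have [->|x0] := eqVneq x 0; first by rewrite dual0 !normr0 mulr0.
have := @dual_norm_ub _ _ f (`|x|^-1 *: x).
rewrite normrZ normfV normr_id mulVf ?normr_eq0// lexx => /(_ isT).
rewrite dual_scale normrM normfV normr_id mulrC ler_pdivrMr ?normr_gt0//.
Qed.

Lemma dual_norm_le_bound f (M : R) :
  0 <= M -> (forall x, `|f x| <= M * `|x|) -> `|f| <= M.
Proof.
move=> M0 fM; apply: dual_norm_le => x x1.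
by rewrite (le_trans (fM x))// ler_piMr.
Qed.
End DualPairing.

(** * Bi-contractive projections and property (U) give property (HB) *)

Section Sufficiency.
Context {R : realType} {X : normedModType R}.

(** The complement [G] is the range of the adjoint of [P]. Strictness is where
    uniqueness enters: since [P] is contractive, [f \o P] is always a
    norm-preserving extension of the restriction of [f] to [Y]. *)
Lemma property_HB_of_U (Y : set X) (P : {linear X -> X}) :
  property_U Y -> projection_onto P Y -> bi_contractive P -> property_HB Y.
Proof.
move=> UY [PP rangeP] [P1 P2].
have YP x : Y (P x) by rewrite -rangeP; exists x.
have PY y : Y y -> P y = y by rewrite -rangeP => -[x _ <-].
have pred_comp (f : dual X) : (f \o P : X -> R^o) \in @dual_pred R X.
  apply/dual_predP; split=> [a x y _ _|] /=.
    by rewrite linearP dualD dual_scale.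
  exists `|f| => x _; rewrite (le_trans (dual_eval_le _ _))//.
  by rewrite ler_wpM2l.
pose Q f : dual X := Dual (pred_comp f).
exists [set f : dual X | forall x, f (P x) = f x]; split.
- have -> : [set f : dual X | forall x, f (P x) = f x] =
      \bigcap_(x in setT) [set f : dual X | f (P x - x) = 0].
    apply/seteqP; split=> f /= fP x.
      by move=> _ /=; rewrite dualB fP subrr.
    by have /eqP := fP x I; rewrite dualB subr_eq0 => /eqP.
  apply: closed_bigI => x _.
  suff /continuous_closedP/(_ _ (@closed_eq R 0)) :
      continuous (fun f : dual X => f (P x - x) : R).
    by [].
  move=> f; apply/(@cvgrPdist_le _ _ _ (nbhs f)) => e e0.
  near=> g; rewrite -dual_evalB (le_trans (dual_eval_le _ _))//.
  have : `|f - g| <= e / (`|P x - x| + 1).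
    near: g; apply: cvgr_dist_le; first exact: cvg_id.
    by rewrite divr_gt0// ltr_wpDl.
  rewrite ler_pdivlMr ?ltr_wpDl//; apply: le_trans.
  by rewrite ler_wpM2l// lerDl.
- split; first by rewrite inE.
  move=> a f g; rewrite !inE /= => fP gP x.
  by rewrite [LHS](dual_evalD (a *: f) g) dual_evalZ fP gP.
- move=> f; exists (Q f), (f - Q f); split=> [x /=|y Yy|].
  + by rewrite PP.
  + by rewrite dual_evalB /= PY// subrr.
  + by rewrite addrC subrK.
- move=> f [/= fP fY]; apply/val_inj/funext => x /=.
  by rewrite -fP fY.
move=> f g h fE gP hY h0.
have gE x : g x = f (P x) by rewrite fE dual_evalD (hY (P x))// addr0 gP.
have hE x : h x = f (x - P x) by rewrite dualB -gE fE dual_evalD addrC addKr.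
have gf : `|g| <= `|f|.
  apply: dual_norm_le_bound => // x; rewrite gE (le_trans (dual_eval_le _ _))//.
  by rewrite ler_wpM2l.
split; last first.
  apply: dual_norm_le_bound => // x; rewrite hE (le_trans (dual_eval_le _ _))//.
  by rewrite ler_wpM2l.
rewrite lt_neqAle gf andbT; apply: contra h0 => /eqP gfn.
have bY : bounded_functional_on Y f.
  split=> [a x y _ _|]; first by rewrite dualD dual_scale.
  by exists `|f| => y _; exact: dual_eval_le.
have fY : `|g| = functional_norm_on Y f.
  apply/eqP; rewrite eq_le; apply/andP; split.
    apply: dual_norm_le => x x1; rewrite gE.
    apply: ub_le_sup; first exact: functional_norm_ub.
    by exists (P x) => //; split=> //=; rewrite (le_trans (P1 x)).
  rewrite gfn; apply: ge_sup; last by move=> _ [x [_ x1] <-]; exact: dual_norm_ub.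
  by exists `|f (P 0)|, (P 0) => //; split=> //=; rewrite linear0 normr0.
have [k [_ kuniq]] := UY _ bY.
have kg : k = g by apply: kuniq; split=> // y Yy; rewrite gE PY.
have kf : k = f by apply: kuniq; rewrite -gfn.
by rewrite -(addKr g h) -fE -kf kg addNr.
Unshelve. all: by end_near. Qed.
End Sufficiency.

(** * The unit vectors and the coordinates of [ell1] *)

Section Ell1Basis.
Context {R : realType}.
Implicit Types (x y : ell1 R) (j k m N : nat).

Lemma ell1_addE x y k : (x + y) k = x k + y k.
Proof. by []. Qed.

Lemma ell1_subE x y k : (x - y) k = x k - y k.
Proof. by []. Qed.

Lemma ell1_scaleE (a : R) x k : (a *: x) k = a * x k.
Proof. by []. Qed.

Lemma ell1_normE x : `|x| = limn (series (fun k => `|x k| : R)).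
Proof. by []. Qed.

Lemma series_abs_le_norm x N : series (fun k => `|x k| : R) N <= `|x|.
Proof.
apply: (nondecreasing_cvgn_le _ (@ell1_cvg R x)).
by apply: nondecreasing_series => i _ _; exact: normr_ge0.
Qed.

Lemma ell1_normD_disjoint x y :
  (forall k, x k = 0 \/ y k = 0) -> `|x + y| = `|x| + `|y|.
Proof.
move=> xy; rewrite !ell1_normE -lim_seriesD; [|exact: ell1_cvg..].
congr (limn (series _)); apply/funext => k.
rewrite ell1_addE !fctE.
by case: (xy k) => ->; rewrite !(add0r, addr0) normr0 !(add0r, addr0).
Qed.

Lemma cvg_series_ebasis k :
  series (fun j => `|(j == k)%:R| : R) @ \oo --> (1 : R).
Proof.
apply: cvg_near_cst; near=> N; rewrite /series/=.
have kN : (k < N)%N by near: N; exact: nbhs_infty_gt.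
rewrite big_mkord (bigD1 (Ordinal kN))//= eqxx normr1 big1 ?addr0// => j.
by rewrite -val_eqE /= => /negbTE ->; rewrite normr0.
Unshelve. all: by end_near. Qed.

Lemma ebasis_subproof k : (fun j => (j == k)%:R : R^o) \in @abs_summable R.
Proof. by apply/abs_summableP; apply/cvg_ex; exists 1; exact: cvg_series_ebasis. Qed.

Definition ebasis k : ell1 R := Ell1 (ebasis_subproof k).

Lemma ebasisE k j : ebasis k j = (j == k)%:R :> R.
Proof. by []. Qed.

Lemma norm_ebasis k : `|ebasis k| = 1.
Proof. by rewrite ell1_normE; apply: cvg_lim => //; exact: cvg_series_ebasis. Qed.

(** This additivity, with equality instead of the triangle inequality, is what
    turns contractivity into the sharp bounds [min(p, 1 - p)] on columns. *)
Lemma ell1_norm_split x k : `|x| = `|x k| + `|x - (x k : R) *: ebasis k|.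
Proof.
rewrite -{1}(subrK ((x k : R) *: ebasis k) x) [LHS]ell1_normD_disjoint.
  by rewrite normrZ norm_ebasis mulr1 addrC.
move=> j; rewrite ell1_subE ell1_scaleE ebasisE.
have [->|_] := eqVneq j k; first by left; rewrite mulr1 subrr.
by right; rewrite mulr0.
Qed.

Lemma coordinate_subproof k :
  (fun x : ell1 R => x k : R^o) \in @dual_pred R (ell1 R).
Proof.
apply/dual_predP; split=> //.
by exists 1 => x _; rewrite mul1r ell1_coord_le.
Qed.

Definition coordinate k : dual (ell1 R) := Dual (coordinate_subproof k).

Lemma coordinateE k x : coordinate k x = x k.
Proof. by []. Qed.

Definition truncate x N : ell1 R := \sum_(j < N) (x j : R) *: ebasis j.

Lemma sub_truncateS x N : x - truncate x N.+1 =
  x - truncate x N - (x N : R) *: ebasis N.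
Proof. by rewrite /truncate big_ord_recr opprD addrA. Qed.

Lemma ell1_sub_truncate x N k :
  (x - truncate x N) k = if (k < N)%N then 0 else x k.
Proof.
elim: N => [|N IH]; first by rewrite /truncate big_ord0 subr0.
rewrite sub_truncateS ell1_subE IH.
rewrite ell1_scaleE ebasisE ltnS [in RHS]leq_eqVlt.
have [->|_] := eqVneq k N; first by rewrite ltnn mulr1 subrr.
by rewrite mulr0 subr0.
Qed.

Lemma norm_sub_truncate x N :
  `|x - truncate x N| = `|x| - series (fun k => `|x k| : R) N.
Proof.
elim: N => [|N IH].
  by rewrite /truncate /series/= big_ord0 big_geq// !subr0.
rewrite /series/= big_nat_recr//= opprD addrA -IH.
rewrite (ell1_norm_split (x - truncate x N) N) ell1_sub_truncate ltnn.
by rewrite addrAC subrr add0r sub_truncateS.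
Qed.

(** One half of the identification of the dual of [ell1] with the bounded
    sequences: the norm of a functional is at most the supremum of its absolute
    values at unit vectors, because truncations converge in norm. *)
Lemma dual_bounded_by_ebasis (f : dual (ell1 R)) (M : R) :
  (forall j, `|f (ebasis j)| <= M) -> forall x, `|f x| <= M * `|x|.
Proof.
move=> fM x.
have M0 : 0 <= M by exact: le_trans (fM 0%N).
have le_trunc N : `|f x| <= M * `|x| + `|f| * `|x - truncate x N|.
  rewrite -{1}(subrK (truncate x N) x) dualD (le_trans (ler_normD _ _))//.
  rewrite addrC lerD ?dual_eval_le// dual_sum.
  apply: (@le_trans _ _ (M * series (fun k => `|x k| : R) N)).
    rewrite /series/= big_mkord mulr_sumr (le_trans (ler_norm_sum _ _ _))//.
    by apply: ler_sum => j _; rewrite dual_scale normrM mulrC ler_wpM2r.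
  by rewrite ler_wpM2l// series_abs_le_norm.
have cvg0 : M * `|x| + `|f| * `|x - truncate x N| @[N --> \oo] --> M * `|x| + `|f| * 0.
  apply: cvgD; first exact: cvg_cst.
  apply: cvgMl_tmp.
  under eq_fun do rewrite norm_sub_truncate.
  rewrite -(subrr `|x|); apply: cvgB; first exact: cvg_cst.
  exact: ell1_cvg.
rewrite -[leRHS]addr0 -(mulr0 `|f|) -(cvg_lim _ cvg0)//.
by apply: limr_ge; [apply/cvg_ex; eexists; exact: cvg0|exact: nearW].
Qed.

(** Finite combinations of coordinates, with the signs of [x] as coefficients,
    compute the partial sums of the norm of [x]. *)
Lemma ell1_norm_le1_dual x :
  (forall f : dual (ell1 R), `|f| <= 1 -> `|f x| <= 1) -> `|x| <= 1.
Proof.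
move=> fx; rewrite ell1_normE; apply: limr_le; first exact: ell1_cvg.
apply: nearW => N.
pose f := \sum_(j < N) Num.sg (x j) *: coordinate j.
have -> : series (fun k => `|x k| : R) N = f x.
  rewrite /series/= big_mkord dual_eval_sum; apply: eq_bigr => j _.
  by rewrite dual_evalZ coordinateE -normrEsg.
rewrite (le_trans (ler_norm _))// fx//.
apply: dual_norm_le_bound => // z; rewrite mul1r dual_eval_sum.
apply: le_trans (ler_norm_sum _ _ _) _.
apply: le_trans (series_abs_le_norm z N).
rewrite /series/= big_mkord; apply: ler_sum => j _.
by rewrite [leLHS]normrM ler_piMl// normr_sg lern1 leq_b1.
Qed.

(** Among the matrices [A N] of the first [N] coordinates of the family, take
    one of maximal rank. Its left kernel cannot shrink as [N] grows, so a vector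
    in it gives a combination with all coordinates zero. Hence the rows are
    free, and a right inverse provides the functionals. *)
Lemma dual_basis_of_free n (b : 'I_n -> ell1 R) :
  (forall c : 'I_n -> R, \sum_(i < n) c i *: b i = 0 -> forall i, c i = 0) ->
  exists f : 'I_n -> dual (ell1 R), forall i j : 'I_n, f i (b j) = (i == j)%:R.
Proof.
move=> bfree.
pose A N : 'M[R]_(n, N) := \matrix_(i < n, k < N) (b i k : R).
pose rk r := `[< exists N, \rank (A N) = r >].
have rk_ex : exists r, rk r by exists (\rank (A 0%N)); apply/asboolP; exists 0%N.
have rk_ub r : rk r -> (r <= n)%N by move=> /asboolP[N <-]; exact: rank_leq_row.
case: (ex_maxnP rk_ex rk_ub) => _ /asboolP[N <-] maxN.
have row_vanish (v : 'rV[R]_n) : v *m A N = 0 -> v = 0.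
  move=> vA0.
  have ker_le M : (N <= M)%N -> (kermx (A M) <= kermx (A N))%MS.
    move=> NM; apply/sub_kermxP/matrixP => i k; rewrite !mxE.
    have /matrixP/(_ i (widen_ord NM k)) := mulmx_ker (A M).
    by rewrite !mxE => kM; rewrite -[RHS]kM; apply: eq_bigr => j _; rewrite !mxE.
  have vA M : (N <= M)%N -> v *m A M = 0.
    move=> NM; apply/sub_kermxP; apply: (@submx_trans _ _ _ _ _ _ (kermx (A N))).
      exact/sub_kermxP.
    rewrite -(mxrank_leqif_sup (ker_le _ NM)) eqn_leq mxrankS ?ker_le//=.
    by rewrite !mxrank_ker leq_sub2l// maxN//; apply/asboolP; exists M.
  apply/rowP => i; rewrite mxE; apply: (bfree (fun i => v 0 i)).
  apply/val_inj/funext => k /=.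
  pose M := maxn N k.+1.
  have kM : (k < M)%N by rewrite leq_max ltnSn orbT.
  have /rowP/(_ (Ordinal kM)) := vA _ (leq_maxl N k.+1).
  rewrite !mxE => vk; rewrite -[RHS]vk.
  rewrite -[LHS](coordinateE k) dual_sum; apply: eq_bigr => j _.
  by rewrite dual_scale mxE.
have /row_freeP[B AB] : row_free (A N).
  by rewrite -kermx_eq0; apply/rowV0P => v /sub_kermxP; exact: row_vanish.
exists (fun i => \sum_(k < N) B k i *: coordinate k) => i j.
have /matrixP/(_ j i) := AB; rewrite !mxE eq_sym => <-.
by rewrite dual_eval_sum; apply: eq_bigr => k _; rewrite dual_evalZ mxE mulrC.
Qed.

End Ell1Basis.

(** * Matrices of bi-contractive projections *)

Section BicontractiveMatrix.
Context {R : realType}.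
Implicit Types (c : nat -> ell1 R) (u : nat -> dual (ell1 R)).

(** The matrix of a projection [P] of [ell1] that is bi-contractive on unit
    vectors: [c k] is its column [P e_k] and the functional [u k] is its row,
    [x |-> (P x) k]. Of [P P = P] only the diagonal, [(P (P e_k)) k = (P e_k) k],
    is recorded. *)
Definition bicontractive_matrix c u :=
  [/\ forall k j, u k (ebasis j) = c j k,
      forall k, u k (c k) = c k k,
      forall k, `|c k| <= 1 &
      forall k, `|ebasis k - c k| <= 1].

Definition offdiag c k : ell1 R := c k - (c k k : R) *: ebasis k.

Lemma offdiagE c k j : j != k -> offdiag c k j = c k j.
Proof.
by move=> /negbTE jk; rewrite ell1_subE ell1_scaleE ebasisE jk mulr0 subr0.
Qed.

Lemma offdiag_diag c k : offdiag c k k = 0.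
Proof. by rewrite ell1_subE ell1_scaleE ebasisE eqxx mulr1 subrr. Qed.

Lemma offdiag_le c u k : bicontractive_matrix c u ->
  `|offdiag c k| <= c k k /\ `|offdiag c k| <= 1 - c k k.
Proof.
move=> [_ _ /(_ k) ck1 /(_ k) ek1].
have := ell1_norm_split (c k) k; rewrite -/(offdiag c k) => ckE.
have := ell1_norm_split (ebasis k - c k) k.
rewrite ell1_subE ebasisE eqxx.
rewrite (_ : _ - _ *: _ = - offdiag c k); last first.
  by rewrite /offdiag scalerBl scale1r opprB opprB addrC addrA subrK.
rewrite normrN => ekE.
rewrite ckE in ck1; rewrite ekE in ek1.
by have := ler_norm (c k k); have := ler_norm (1 - c k k : R); split; lra.
Qed.

(** The entries [c j k] of the row [k] off the diagonal are bounded by both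
    [c j j] and [1 - c j j], hence by one half. *)
Lemma offdiag_row_le c u k (x : ell1 R) : bicontractive_matrix c u ->
  x k = 0 -> `|u k x| <= 2^-1 * `|x|.
Proof.
move=> cu xk0; have [uE _ _ _] := cu.
pose f := u k - u k (ebasis k) *: coordinate k.
have fE y : f y = u k y - u k (ebasis k) * y k by [].
have -> : u k x = f x by rewrite fE xk0 mulr0 subr0.
apply: dual_bounded_by_ebasis => j; rewrite fE ebasisE.
have [<-|jk] := eqVneq k j; first by rewrite mulr1 subrr normr0 invr_ge0.
rewrite mulr0 subr0 uE -offdiagE//.
have : `|offdiag c j k| <= `|offdiag c j| by exact: ell1_coord_le.
have [] := offdiag_le c u j cu; lra.
Qed.

Lemma diag_idempotent c u k : bicontractive_matrix c u ->
  c k k = c k k * c k k + u k (offdiag c k) :> R.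
Proof.
move=> [uE uc _ _]; rewrite /offdiag dualB dual_scale uE uc.
by rewrite addrC subrK.
Qed.

(** With [p = c k k], the diagonal identity and the bounds on the off-diagonal
    part give [p (1 - p) <= p / 2], which leaves [p = 0] or [p >= 1/2]. *)
Lemma small_diag_zero_col c u k : bicontractive_matrix c u ->
  (c k k : R) < 2^-1 -> c k = 0.
Proof.
move=> cu small; have [r1 r2] := offdiag_le c u k cu.
have := diag_idempotent c u k cu.
have := offdiag_row_le c u k _ cu (offdiag_diag c k).
rewrite ler_norml => /andP[_ s1] pE.
have p0 : c k k = 0 :> R.
  have := normr_ge0 (offdiag c k); nra.
have : offdiag c k = 0.
  by apply/eqP; rewrite -normr_le0 -p0.
by rewrite /offdiag p0 scale0r subr0.
Qed.

(** In a column [j], the entry at [k] adds to the norm of the off-diagonal part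
    but, as [u j (ebasis k) = c k j = 0], not to the diagonal identity. So with
    [p = c j j] that entry is at most [min(p, 1 - p) - 2 p (1 - p) <= 0]. *)
Lemma zero_col_zero_row c u k : bicontractive_matrix c u -> c k = 0 -> u k = 0.
Proof.
move=> cu ck0; have [uE _ _ _] := cu.
have u0 j : u k (ebasis j) = 0.
  rewrite uE; have [->|jk] := eqVneq j k; first by rewrite ck0.
  have [r1 r2] := offdiag_le c u j cu.
  have pE := diag_idempotent c u j cu.
  have kj : k != j by rewrite eq_sym.
  (* the off-diagonal part of the column [j] without its entry at [k] *)
  pose s := offdiag c j - (offdiag c j k : R) *: ebasis k.
  have sj : s j = 0.
    by rewrite ell1_subE ell1_scaleE ebasisE (negbTE jk) offdiag_diag mulr0 subr0.
  have usE : u j (offdiag c j) = u j s.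
    by rewrite [RHS]dualB dual_scale uE ck0 mulr0 subr0.
  have := offdiag_row_le c u j _ cu sj.
  have := ell1_norm_split (offdiag c j) k; rewrite -/s offdiagE// => rE.
  rewrite ler_norml => /andP[_ us].
  apply/eqP; rewrite -normr_le0.
  rewrite usE in pE.
  have a0 := normr_ge0 s.
  have [ph|ph] := lerP (c j j : R) 2^-1; nra.
apply/val_inj/funext => x /=.
by apply/eqP; rewrite -normr_le0 -(mul0r `|x|) dual_bounded_by_ebasis// => j;
  rewrite u0 normr0.
Qed.

Lemma bicontractive_matrix_zero_row c u : bicontractive_matrix c u ->
  (c k k : R) @[k --> \oo] --> (0 : R) -> exists k, u k = 0.
Proof.
move=> cu c0.
have [k _ /(_ k (leqnn k)) small] : \forall k \near \oo, (c k k : R) < 2^-1.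
  by apply: cvgr_lt c0 _ _; rewrite invr_gt0.
by exists k; apply: (zero_col_zero_row c u k cu);
  exact: (small_diag_zero_col c u k cu small).
Qed.

End BicontractiveMatrix.

(** * Property (HB) forces a finite-dimensional subspace to be zero *)

Section Necessity.
Context {R : realType}.

(** If [Y] vanished at [k], then [g] could be moved along [coordinate k] until
    its value at the unit vector is plus or minus its norm. One of these two
    moves is nontrivial, and it does not increase the norm. *)
Lemma property_HB_not_vanishing (Y : set (ell1 R)) (G : set (dual (ell1 R)))
    (g : dual (ell1 R)) k :
  (forall f g h : dual (ell1 R), f = g + h -> G g -> annihilator Y h ->
     h != 0 -> `|g| < `|f|) ->
  G g -> g != 0 -> ~ annihilator Y (coordinate k).
Proof.
move=> strict Gg g0 Yk.
have ng0 : 0 < `|g| by rewrite normr_gt0.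
pose s := if g (ebasis k) == `|g| then - `|g| else `|g|.
have sn : `|s| = `|g| by rewrite /s; case: ifP => _; rewrite ?normrN normr_id.
have t0 : s - g (ebasis k) != 0.
  rewrite /s; case: ifPn => [/eqP ->|ne]; last by rewrite subr_eq0 eq_sym.
  by rewrite lt_eqF//; lra.
pose h := (s - g (ebasis k)) *: coordinate k.
have hE x : h x = (s - g (ebasis k)) * x k by [].
have Yh : annihilator Y h by move=> y /Yk; rewrite hE coordinateE => ->; rewrite mulr0.
have h0 : h != 0.
  apply: contra t0 => /eqP /(congr1 (fun f : dual (ell1 R) => f (ebasis k))).
  by rewrite hE ebasisE eqxx mulr1 => ->.
have := strict _ _ _ erefl Gg Yh h0; rewrite ltNge => /negP; apply.
apply: dual_norm_le_bound => //; apply: dual_bounded_by_ebasis => j.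
rewrite dual_evalD hE ebasisE; have [->|_] := eqVneq j k.
  by rewrite mulr1 addrC subrK sn.
by rewrite mulr0 addr0 (le_trans (dual_eval_le _ _))// norm_ebasis mulr1.
Qed.

(** The pre-adjoint of the projection onto [G] is [x |-> \sum_i g_i x *: b_i] for
    the basis [g_i] of [G] dual to the basis [b_i] of [Y]. The [k]-th diagonal
    entry of its matrix is then a sum of [n] terms bounded by multiples of
    [`|b_i k|], so it tends to 0. *)
Lemma property_HB_dim0 (Y : set (ell1 R)) n :
  has_dim Y n -> property_HB Y -> n = 0%N.
Proof.
case: n => [//|n] [b [bfree YE]] [G [_ [G0 GP] dec triv strict]].
exfalso.
have Yb i : Y (b i).
  rewrite YE; exists (fun j => (j == i)%:R) => //.
  rewrite (bigD1 i)//= eqxx scale1r big1 ?addr0// => j /negbTE ->.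
  by rewrite scale0r.
have Gsum (I : Type) (r : seq I) (a : I -> R) (F : I -> dual (ell1 R)) :
    (forall i, G (F i)) -> G (\sum_(i <- r) a i *: F i).
  move=> GF; elim/big_rec: _ => [|i g _ Gg]; first exact: set_mem G0.
  by apply: set_mem; apply: GP; apply: mem_set.
have [f fb] := dual_basis_of_free n.+1 b bfree.
have [g gP] := choice (fun i => dec (f i)).
have Gg i : G (g i) by have [h []] := gP i.
(* Adding elements of the annihilator of [Y] does not affect biorthogonality. *)
have gb i j : g i (b j) = (i == j)%:R.
  have [h [_ Yh fE]] := gP i.
  by rewrite -fb fE dual_evalD (Yh _ (Yb j)) addr0.
pose c k : ell1 R := \sum_i g i (ebasis k) *: b i.
have Yc k : Y (c k) by rewrite YE; exists (fun i => g i (ebasis k)).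
have Gc k (g' : dual (ell1 R)) : G g' -> g' (c k) = g' (ebasis k).
  move=> Gg'; have g'E : g' = \sum_i g' (b i) *: g i.
    apply/eqP; rewrite -subr_eq0; apply/eqP.
    apply: triv; split.
      rewrite -scaleN1r addrC; apply: set_mem.
      by apply: GP; apply: mem_set => //; exact: Gsum.
    move=> y; rewrite YE => -[a _ <-].
    apply/eqP; rewrite dual_evalB subr_eq0 dual_eval_sum; apply/eqP.
    rewrite [LHS]dual_sum; apply: eq_bigr => i _.
    rewrite dual_scale dual_evalZ dual_sum (bigD1 i)//= dual_scale gb eqxx mulr1.
    rewrite big1 ?addr0 1?mulrC// => j ji.
    by rewrite dual_scale gb eq_sym (negbTE ji) mulr0.
  rewrite [in RHS]g'E dual_eval_sum dual_sum; apply: eq_bigr => i _.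
  by rewrite dual_scale dual_evalZ mulrC.
have [u uP] := choice (fun k => dec (coordinate k)).
have cu : bicontractive_matrix c u.
  split=> [k j|k|k|k].
  - have [v [Gu Yv kE]] := uP k.
    by rewrite -(Gc _ _ Gu) -[RHS]coordinateE kE dual_evalD (Yv _ (Yc j)) addr0.
  - have [v [Gu Yv kE]] := uP k.
    by rewrite -[RHS]coordinateE kE dual_evalD (Yv _ (Yc k)) addr0.
  - apply: ell1_norm_le1_dual => f' f1; have [g' [h' [Gg' Yh' fE]]] := dec f'.
    rewrite fE dual_evalD (Yh' _ (Yc k)) addr0 Gc//.
    rewrite (le_trans (dual_eval_le _ _))// norm_ebasis mulr1 (le_trans _ f1)//.
    have [h0|h0] := eqVneq h' 0; first by rewrite fE h0 addr0.
    by have [/ltW] := strict _ _ _ fE Gg' Yh' h0.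
  - apply: ell1_norm_le1_dual => f' f1; have [g' [h' [Gg' Yh' fE]]] := dec f'.
    rewrite dualB fE !dual_evalD (Yh' _ (Yc k)) addr0 Gc// addrC addKr.
    rewrite (le_trans (dual_eval_le _ _))// norm_ebasis mulr1 (le_trans _ f1)//.
    have [->|h0] := eqVneq h' 0; first by rewrite normr0.
    by have [_] := strict _ _ _ fE Gg' Yh' h0.
have c0 : (c k k : R) @[k --> \oo] --> (0 : R).
  have -> : (fun k => c k k : R) = fun k => \sum_i g i (ebasis k) * b i k.
    apply/funext => k; rewrite -[LHS]coordinateE dual_sum.
    by apply: eq_bigr => i _; rewrite dual_scale.
  have sum0 : \sum_(i < n.+1) (0 : R) = 0 by rewrite big1.
  rewrite -[X in _ --> X]sum0.
  apply: cvg_big => [|i _]; first exact: add_continuous.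
  apply: norm_cvg0; apply: (@squeeze_cvgr _ _ _ _ (cst 0) (fun k => `|g i| * `|b i k|)).
  - apply: nearW => k; rewrite normr_ge0/= normrM ler_wpM2r//.
    by rewrite (le_trans (dual_eval_le _ _))// norm_ebasis mulr1.
  - exact: cvg_cst.
  - rewrite -[X in _ --> X](mulr0 `|g i|); apply: cvgMl_tmp.
    exact: cvg_series_cvg_0 (@ell1_cvg R (b i)).
have [k uk0] := bicontractive_matrix_zero_row c u cu c0.
have [v [_ Yv kE]] := uP k.
have g0 : g ord0 != 0.
  apply/eqP => /(congr1 (fun f : dual (ell1 R) => f (b ord0))).
  by rewrite gb eqxx => /eqP; rewrite oner_eq0.
apply: (property_HB_not_vanishing Y G (g ord0) k _ (Gg ord0) g0).
  by move=> ? ? ? fE Gg' Yh h0; have [] := strict _ _ _ fE Gg' Yh h0.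
by rewrite kE uk0 add0r.
Qed.
End Necessity.

(** * The zero subspace *)

Section ZeroSubspace.
Context {R : realType}.

Lemma has_dim0 (X : normedModType R) (Y : set X) : has_dim Y 0 -> Y = [set 0].
Proof.
move=> [b [_ ->]]; apply/seteqP; split=> [_ [c _ <-]|_ ->] /=.
  by rewrite big_ord0.
by exists (fun=> 0) => //; rewrite big_ord0.
Qed.

Lemma property_U_set0 (X : normedModType R) : property_U [set (0 : X)].
Proof.
move=> g [lg _].
have g0 : g 0 = 0.
  by have := lg (-1) 0 0 erefl erefl; rewrite scaler0 addr0 mulN1r addNr.
have norm0 : functional_norm_on [set 0] g = 0.
  rewrite /functional_norm_on (_ : [set _ | _ in _] = [set 0]) ?sup1//.
  apply/seteqP; split=> [_ [_ [-> _] <-]|_ ->] /=; first by rewrite g0 normr0.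
  by exists 0; [split=> //=; rewrite normr0|rewrite g0 normr0].
exists 0; split; first by rewrite norm0 normr0; split=> // y ->; rewrite dual0 g0.
by move=> f [_]; rewrite norm0 => /eqP; rewrite normr_eq0 => /eqP.
Qed.

Lemma projection_set0 (X : normedModType R) :
  exists P : {linear X -> X},
    [/\ projection_onto P [set 0], bi_contractive P,
        isometrically_isomorphic (fin_ell1 R 0) [set (0 : X)] &
        isometrically_isomorphic X (range (fun x => x - P x))].
Proof.
exists \0; split.
- by split=> //; apply/seteqP; split=> [_ [x _ <-]|_ ->] //; exists 0.
- by split=> x /=; rewrite ?subr0 ?normr0.
- exists \0; split=> [z|].
    by rewrite /= normr0; apply/esym; exact: big_ord0.
  by apply/seteqP; split=> [_ [x _ <-]|_ ->] //; exists 0.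
exists idfun; split=> //.
by apply/seteqP; split=> [_ [x _ <-]|_ [x _ <-]]; exists x => //=; rewrite subr0.
Qed.

End ZeroSubspace.

(** * The characterization *)

Theorem theorem3p5 (R : realType) (n : nat) (Y : set (ell1 R))
    (dimY : has_dim Y n) :
  property_HB Y <->
  property_U Y /\
  exists P : {linear ell1 R -> ell1 R},
    [/\ projection_onto P Y, bi_contractive P,
        isometrically_isomorphic (fin_ell1 R n) Y &
        isometrically_isomorphic (ell1 R) (range (fun x => x - P x))].
Proof.
split=> [HBY|[UY [P [PY P1 _ _]]]]; last exact: property_HB_of_U UY PY P1.
have n0 := property_HB_dim0 Y n dimY HBY.
rewrite n0 in dimY *; rewrite (has_dim0 _ _ dimY).
by split; [exact: property_U_set0|exact: projection_set0].
Qed.
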